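(* Let $\mathfrak{n}$ be the four-dimensional real Lie algebra with basis $e_2,e_3,e_4,e_5$ whose only nonzero Lie bracket among basis elements (up to skew-symmetry) is $[e_2,e_3]=e_5$; thus $\mathfrak{n}\cong\mathbb{R}\oplus\mathfrak{h}_3$, where $\mathfrak{h}_3=\mathrm{span}\{e_2,e_3,e_5\}$ is the three-dimensional Heisenberg Lie algebra, and $\mathfrak{n}$ is 2-step nilpotent. Let $\langle\,,\,\rangle$ be the symmetric bilinear form on $\mathfrak{n}$ whose only nonzero values on basis elements (up to symmetry) are $$-\langle e_2,e_4\rangle=\langle e_3,e_3\rangle=\langle e_5,e_5\rangle=1.$$ Let $N$ be the simply connected Lie group with Lie algebra $\mathfrak{n}$, equipped with the left-invariant pseudo-Riemannian metric determined by $\langle\,,\,\rangle$. Then: (i) the center of $\mathfrak{n}$, which is $\mathrm{span}\{e_4,e_5\}$, is degenerate for $\langle\,,\,\rangle$; (ii) $N$ with this metric is a naturally reductive pseudo-Riemannian manifold; (iii) $\langle\,,\,\rangle$ is not ad-invariant on $\mathfrak{n}$, i.e. the metric on $N$ is not bi-invariant.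
   Context: Naturally reductive: a homogeneous pseudo-Riemannian manifold $M$ is naturally reductive if there is a Lie group $G$ acting transitively on $M$ by isometries, with Lie algebra $\mathfrak{g}$ and with isotropy subgroup $H$ (at a point $p$) having Lie algebra $\mathfrak{h}$, and a subspace $\mathfrak{m}\subseteq\mathfrak{g}$ complementary to $\mathfrak{h}$ in $\mathfrak{g}$, such that $\mathrm{Ad}(H)\mathfrak{m}\subseteq\mathfrak{m}$ and $\langle[x,y]_{\mathfrak{m}},z\rangle+\langle y,[x,z]_{\mathfrak{m}}\rangle=0$ for all $x,y,z\in\mathfrak{m}$. Here $[\,,\,]_{\mathfrak{m}}$ is the $\mathfrak{m}$-component of the bracket along $\mathfrak{g}=\mathfrak{h}\oplus\mathfrak{m}$, and $\langle\,,\,\rangle$ on $\mathfrak{m}$ is the metric of $T_pM$ transported through the natural identification $\mathfrak{m}\cong\mathfrak{g}/\mathfrak{h}\cong T_pM$. The group $G$ is not required to be a prescribed group; a metric on $M$ is called naturally reductive if some such $G$ exists. A subspace $W$ of a space with a nondegenerate symmetric bilinear form is degenerate if the restriction of the form to $W$ is degenerate. A nondegenerate symmetric bilinear form $\langle\,,\,\rangle$ on a Lie algebra $\mathfrak{n}$ is ad-invariant if $\langle[x,y],z\rangle+\langle y,[x,z]\rangle=0$ for all $x,y,z\in\mathfrak{n}$. *)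

(* Defs.v *)
From HB Require Import structures.
From mathcomp Require Import all_boot all_order all_algebra.
From mathcomp Require Import all_classical all_reals all_analysis.

Set Implicit Arguments.
Unset Strict Implicit.
Unset Printing Implicit Defensive.

Import Order.TTheory GRing.Theory Num.Theory.
Import numFieldNormedType.Exports.

Local Open Scope classical_set_scope.
Local Open Scope ring_scope.

(* [class_C k U f]: f is of class C^k at every point of the open set U. The
   derivative is tested against one fixed vector v at a time, which is
   equivalent to C^k regularity of x |-> 'd f x because V is always finite
   dimensional below. *)
Fixpoint class_C (R : realType) (V W : normedModType R) (k : nat)
    (U : set V) (f : V -> W) : Prop :=
  if k is k'.+1 then
    (forall x, U x -> differentiable f x) /\
    (forall v, class_C k' U (fun x => 'd f x v))
  else forall x, U x -> {for x, continuous f}.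

Definition smooth_on (R : realType) (V W : normedModType R)
    (U : set V) (f : V -> W) : Prop :=
  forall k, class_C k U f.

(* [coord] is only meaningful on [dom], and [param] (its inverse) only on
   [cod]. *)
Record chart (T V : Type) := Chart {
  dom : set T;
  coord : T -> V;
  param : V -> T }.

Definition cod (T V : Type) (c : chart T V) : set V := coord c @` dom c.

Definition is_chart (T : topologicalType) (R : realType) (V : normedModType R)
    (c : chart T V) : Prop :=
  [/\ open (dom c),
      open (cod c),
      forall p, dom c p -> param c (coord c p) = p,
      forall p, dom c p -> {for p, continuous (coord c)} &
      forall u, cod c u -> {for u, continuous (param c)}].

(* A space with an atlas modelled on V and, for each point p, a preferred chart
   [chart_at p] of the atlas around p. The tangent space at p is V itself: a
   tangent vector is represented by its components in the chart [chart_at p].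
   The axioms are in [is_manifold]. *)
Record mfd (R : realType) (V : normedModType R) := Mfd {
  pts :> topologicalType;
  atlas : set (chart pts V);
  chart_at : pts -> chart pts V }.

Arguments atlas {R V} _ _.

Definition is_manifold (R : realType) (V : normedModType R) (M : mfd V) : Prop :=
  [/\ hausdorff_space M,
      @second_countable M,
      forall c, atlas M c -> is_chart c,
      forall p : M, atlas M (chart_at p) /\ dom (chart_at p) p &
      forall c d, atlas M c -> atlas M d ->
        smooth_on (coord c @` (dom c `&` dom d)) (coord d \o param c)].

Definition smooth_map (R : realType) (V W : normedModType R)
    (M : mfd V) (N : mfd W) (f : M -> N) : Prop :=
  continuous f /\
  forall c d, atlas M c -> atlas N d ->
    smooth_on (cod c `&` [set u | dom d (f (param c u))])
              (coord d \o f \o param c).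

(* The differential T_p M -> T_(f p) N. *)
Definition tmap (R : realType) (V W : normedModType R) (M : mfd V) (N : mfd W)
    (f : M -> N) (p : M) (v : V) : W :=
  'd (coord (chart_at (f p)) \o f \o param (chart_at p))
     (coord (chart_at p) p) v.

Definition id_chart (V : Type) : chart V V := Chart setT id id.

Definition model_mfd (R : realType) (V : normedModType R) : mfd V :=
  @Mfd R V V [set id_chart V] (fun=> id_chart V).

Definition prod_chart (T V T' V' : Type) (c : chart T V) (d : chart T' V') :
    chart (T * T') (V * V') :=
  Chart (dom c `*` dom d)
        (fun x => (coord c x.1, coord d x.2))
        (fun u => (param c u.1, param d u.2)).

Definition prod_mfd (R : realType) (V W : normedModType R)
    (M : mfd V) (N : mfd W) : mfd (V * W)%type :=
  @Mfd R (V * W)%type (M * N)%type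
    [set prod_chart c d | c in atlas M & d in atlas N]
    (fun x => prod_chart (chart_at x.1) (chart_at x.2)).

Definition simply_connected (R : realType) (T : topologicalType) : Prop :=
  [/\ [set: T] !=set0,
      forall x y : T, exists f : R -> T,
        [/\ {within `[0, 1], continuous f}, f 0 = x & f 1 = y] &
      forall f : R -> T, {within `[0, 1], continuous f} -> f 0 = f 1 ->
        exists h : R * R -> T,
          {within `[0, 1] `*` `[0, 1], continuous h} /\
          forall t : R, t \in `[0, 1] ->
            [/\ h (0, t) = f t, h (1, t) = f 0, h (t, 0) = f 0 &
                h (t, 1) = f 0]].

Section lie_algebra.
Context (R : realType) (n : nat).
Implicit Types (br : 'rV[R]_n -> 'rV[R]_n -> 'rV[R]_n) (W : {vspace 'rV[R]_n}).

Definition is_lie_algebra br : Prop :=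
  [/\ forall x, linear (br x),
      forall y, linear (br ^~ y),
      forall x, br x x = 0 &
      forall x y z, br x (br y z) + br y (br z x) + br z (br x y) = 0].

Definition lie_center br : set 'rV[R]_n := [set x | forall y, br x y = 0].

Definition is_ideal br W : Prop := forall x y, y \in W -> br x y \in W.

Definition two_step_nilpotent br : Prop :=
  (exists x y, br x y <> 0) /\ forall x y z, br (br x y) z = 0.

End lie_algebra.

Section bilinear_forms.
Context (R : realType) (n : nat).
Implicit Types (B : 'rV[R]_n -> 'rV[R]_n -> R) (W : {vspace 'rV[R]_n}).

Definition degenerate_on B W : Prop :=
  exists x, [/\ x \in W, x <> 0 & forall y, y \in W -> B x y = 0].

Definition is_pseudo_scalar_product B : Prop :=
  [/\ forall x, scalar (B x),
      forall x y, B x y = B y x &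
      ~ degenerate_on B fullv].

Definition ad_invariant (br : 'rV[R]_n -> 'rV[R]_n -> 'rV[R]_n) B : Prop :=
  forall x y z, B (br x y) z + B y (br x z) = 0.

End bilinear_forms.

(* Only the data; the axioms are in [is_lie_group]. *)
Record lie_group (R : realType) (n : nat) := LieGroup {
  lie_mfd :> mfd 'rV[R]_n;
  lmul : lie_mfd -> lie_mfd -> lie_mfd;
  linv : lie_mfd -> lie_mfd;
  lone : lie_mfd }.

Arguments lone {R n} _.

Definition is_lie_group (R : realType) (n : nat) (G : lie_group R n) : Prop :=
  [/\ is_manifold G,
      associative (@lmul R n G),
      left_id (lone G) (@lmul R n G) /\ right_id (lone G) (@lmul R n G),
      left_inverse (lone G) (@linv R n G) (@lmul R n G) /\
        right_inverse (lone G) (@linv R n G) (@lmul R n G) &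
      smooth_map (M := prod_mfd G G) (N := G) (fun x => lmul x.1 x.2) /\
        smooth_map (@linv R n G)].

Section lie_group_theory.
Context (R : realType) (n : nat) (G : lie_group R n).

(* Components, in the preferred chart around 1, of the left-invariant vector
   field generated by v in T_1 G, at the point with coordinates u. *)
Definition left_invariant_field (v u : 'rV[R]_n) : 'rV[R]_n :=
  let c := chart_at (lone G) in
  'd (fun y => coord c (lmul (param c u) (param c y))) (coord c (lone G)) v.

(* The bracket of the Lie algebra T_1 G: the value at 1 of the commutator
   [X, Y] = DY(X) - DX(Y) of the left-invariant fields X, Y through v, w. *)
Definition lie_bracket (v w : 'rV[R]_n) : 'rV[R]_n :=
  let u := coord (chart_at (lone G)) (lone G) in
  let X := left_invariant_field v in
  let Y := left_invariant_field w in
  'd Y u (X u) - 'd X u (Y u).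

Definition Ad (a : G) (v : 'rV[R]_n) : 'rV[R]_n :=
  tmap (fun x => lmul (lmul a x) (linv a)) (lone G) v.

Definition one_parameter_subgroup (gamma : R -> G) : Prop :=
  smooth_map (M := model_mfd R^o) (N := G) gamma /\
  forall s t, gamma (s + t) = lmul (gamma s) (gamma t).

(* The Lie algebra { v | exp(t v) in H for all t } of a closed subgroup H. *)
Definition lie_algebra_of (H : set G) : set 'rV[R]_n :=
  [set v | exists gamma : R -> G,
    [/\ one_parameter_subgroup gamma, forall t, H (gamma t) &
        v = tmap (M := model_mfd R^o) (N := G) gamma 0 1]].

End lie_group_theory.

(* g p is a bilinear form on T_p M. *)
Notation metric M n R := (pts M -> 'rV[R]_n -> 'rV[R]_n -> R).

(* Smoothness is that of the components of g in every chart c of the atlas: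
   [to_preferred c u] takes components in c to components in the preferred
   chart at [param c u]. *)
Definition to_preferred (R : realType) (n : nat) (M : mfd 'rV[R]_n)
    (c : chart M 'rV[R]_n) (u v : 'rV[R]_n) : 'rV[R]_n :=
  'd (coord (chart_at (param c u)) \o param c) u v.

Definition is_pseudo_riemannian (R : realType) (n : nat) (M : mfd 'rV[R]_n)
    (g : metric M n R) : Prop :=
  (forall p, is_pseudo_scalar_product (g p)) /\
  forall c, atlas M c -> forall v w,
    @smooth_on R 'rV[R]_n R^o (cod c)
      (fun u => g (param c u) (to_preferred c u v) (to_preferred c u w)).

Definition preserves_metric (R : realType) (n : nat) (M : mfd 'rV[R]_n)
    (g : metric M n R) (f : M -> M) : Prop :=
  forall p v w, g (f p) (tmap f p v) (tmap f p w) = g p v w.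

Definition is_isometric_action (R : realType) (n k : nat) (M : mfd 'rV[R]_n)
    (g : metric M n R) (G : lie_group R k) (act : G -> M -> M) : Prop :=
  [/\ forall p, act (lone G) p = p,
      forall a b p, act (lmul a b) p = act a (act b p),
      smooth_map (M := prod_mfd G M) (N := M) (fun x => act x.1 x.2) &
      forall a, preserves_metric g (act a)].

(* [tmap (act ^~ p) 1 : T_1 G -> T_p M] is the differential of the orbit map,
   which induces the identification m = T_1 G / h = T_p M; [daddv_pi m h] is the
   projection onto m along h. *)
Definition naturally_reductive (R : realType) (n : nat) (M : mfd 'rV[R]_n)
    (g : metric M n R) : Prop :=
  [/\ is_manifold M, is_pseudo_riemannian g &
  exists (k : nat) (G : lie_group R k) (act : G -> M -> M) (p : M)
         (h m : {vspace 'rV[R]_k}),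
    let H : set G := [set a | act a p = p] in
    let brm x y := daddv_pi m h (lie_bracket G x y) in
    let ip x y :=
      g p (tmap (act ^~ p) (lone G) x) (tmap (act ^~ p) (lone G) y) in
    [/\ is_lie_group G /\ is_isometric_action g act,
        forall x y, exists a, act a x = y,
        lie_algebra_of H = [set v | v \in h] /\
          (h + m = fullv)%VS /\ (h :&: m = 0)%VS,
        forall a x, H a -> x \in m -> Ad a x \in m &
        forall x y z, x \in m -> y \in m -> z \in m ->
          ip (brm x y) z + ip y (brm x z) = 0]].

Definition left_invariant_metric (R : realType) (n : nat) (G : lie_group R n)
    (B : 'rV[R]_n -> 'rV[R]_n -> R) : metric G n R :=
  fun p v w => B (tmap (lmul (linv p)) p v) (tmap (lmul (linv p)) p w).

Definition bi_invariant (R : realType) (n : nat) (G : lie_group R n)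
    (g : metric G n R) : Prop :=
  forall a, preserves_metric g (lmul a) /\ preserves_metric g (fun x => lmul x a).

(* For a 2-step nilpotent Lie algebra, the Baker-Campbell-Hausdorff product
   x + y + [x, y] / 2 on the underlying vector space is the group law of the
   simply connected Lie group with that Lie algebra, in exponential
   coordinates. *)
Definition bch2_group (R : realType) (n : nat)
    (br : 'rV[R]_n -> 'rV[R]_n -> 'rV[R]_n) : lie_group R n :=
  @LieGroup R n (model_mfd 'rV[R]_n)
    (fun x y => x + y + 2^-1 *: br x y) (fun x => - x) 0.

Definition i2 : 'I_4 := @Ordinal 4 0 isT.
Definition i3 : 'I_4 := @Ordinal 4 1 isT.
Definition i4 : 'I_4 := @Ordinal 4 2 isT.
Definition i5 : 'I_4 := @Ordinal 4 3 isT.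

Section the_algebra.
Context (R : realType).

Definition e2 : 'rV[R]_4 := delta_mx 0 i2.
Definition e3 : 'rV[R]_4 := delta_mx 0 i3.
Definition e4 : 'rV[R]_4 := delta_mx 0 i4.
Definition e5 : 'rV[R]_4 := delta_mx 0 i5.

Definition n_bracket (x y : 'rV[R]_4) : 'rV[R]_4 :=
  (x 0 i2 * y 0 i3 - x 0 i3 * y 0 i2) *: e5.

Definition n_form (x y : 'rV[R]_4) : R :=
  - (x 0 i2 * y 0 i4 + x 0 i4 * y 0 i2) + x 0 i3 * y 0 i3 + x 0 i5 * y 0 i5.

End the_algebra.

Arguments e2 {R}.
Arguments e3 {R}.
Arguments e4 {R}.
Arguments e5 {R}.
Arguments n_bracket {R}.
Arguments n_form {R}.

(* Main.v *)
Require Import Defs.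
From HB Require Import structures.
From mathcomp Require Import all_boot all_order all_algebra.
From mathcomp Require Import all_classical all_reals all_analysis.
From mathcomp Require Import ring.

Set Implicit Arguments.
Unset Strict Implicit.
Unset Printing Implicit Defensive.

Import Order.TTheory GRing.Theory Num.Theory.
Import numFieldNormedType.Exports.

Local Open Scope classical_set_scope.
Local Open Scope ring_scope.

(** Write D for the linear map of n sending e2 to e3, e3 to e4 and e4, e5 to 0.
    It is a derivation of n that is skew for the form, and D^3 = 0, so that
    exp(sD) = 1 + sD + s^2 D^2 / 2 is a one-parameter group of isometric
    automorphisms of N. The left-invariant metric is therefore invariant under
    the five-dimensional group G = N x| R, in which R acts by exp(sD), and the
    isotropy group of the identity of N is the factor R, with Lie algebra
    h = R D.

    The subspace n itself is a poor complement of h, because the form is not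
    ad-invariant. The right one is m = span(e2, e3, e4, e5 + D), the set of
    x + x5 D with x in n. It is invariant under exp(sD), which changes neither
    the e5-coordinate nor the D-component. Modulo h, the bracket of x + x5 D
    and y + y5 D is T(x, y) = [x, y] + x5 Dy - y5 Dx. Now
    [x, y], z pair to (x2 y3 - x3 y2) z5, and Dy, z pair to y2 z3 - y3 z2, so
    that the trilinear form (T(x, y), z) is the 3 x 3 determinant of the
    coordinates 2, 3, 5 of x, y, z. Its antisymmetry in y and z is
    the identity that natural reductivity asks for
    ([g_naturally_reductive]).

    Both groups are vector spaces with polynomial operations, so every
    differential in the definitions is computed symbolically: [polyf] pairs a
    polynomial function with its differential, [poly_map] does so for maps to
    row vectors, and smoothness follows because a directional derivative of a
    polynomial is a polynomial. The Lie bracket of G, the isotropy algebra and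
    the adjoint action of the isotropy group come out of this calculus
    ([ext_group_bracket], [isotropy_algebra], [Ad_isotropy]). The negative
    statements are refuted on e2, e3 and e5. *)

(** * Polynomial functions and their differentials *)

Section polynomial_functions.
Context (R : realType) (V : normedModType R).

(** A syntax for the polynomial functions on V together with their
    differentials. The second index makes the differential a computed term: a
    proof by the constructors fills it in. *)
Inductive polyf : (V -> R) -> (V -> V -> R) -> Prop :=
| polyf_cst (c : R) : polyf (fun=> c) (fun _ _ => 0)
| polyf_lin (l : {linear V -> R}) : continuous l -> polyf l (fun=> l)
| polyfD f df g dg : polyf f df -> polyf g dg ->
    polyf (fun x => f x + g x) (fun x v => df x v + dg x v)
| polyfM f df g dg : polyf f df -> polyf g dg ->
    polyf (fun x => f x * g x) (fun x v => f x * dg x v + g x * df x v).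

Lemma polyf_eq f df dg : polyf f df -> (forall x v, df x v = dg x v) ->
  polyf f dg.
Proof.
move=> fdf e; rewrite -(_ : df = dg) //.
by apply/funext => x; apply/funext => v.
Qed.

Lemma polyfN f df : polyf f df -> polyf (fun x => - f x) (fun x v => - df x v).
Proof.
move=> fdf; rewrite (_ : (fun _ => _) = (fun x => -1 * f x)); last first.
  by apply/funext => x; rewrite mulN1r.
apply: polyf_eq (polyfM (polyf_cst (-1)) fdf) _ => x v.
by rewrite mulr0 addr0 mulN1r.
Qed.

Lemma polyf_is_diff f df x : polyf f df -> is_diff x f (df x).
Proof.
elim=> {f df} [c|l lc|f df g dg _ fdf _ gdg|f df g dg _ fdf _ gdg].
- exact: is_diff_cst.
- by apply: DiffDef; [exact: linear_differentiable|exact: diff_lin].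
- exact: is_diffD.
- exact: is_diffM.
Qed.

(** The closure property that lets one iterate differentiation. *)
Lemma polyf_derive f df v : polyf f df -> exists d2f, polyf (df ^~ v) d2f.
Proof.
elim=> {f df} [c|l lc|f df g dg _ [d2f ?] _ [d2g ?]
              |f df g dg fdf [d2f ?] gdg [d2g ?]].
- by exists (fun _ _ => 0); exact: polyf_cst.
- by exists (fun _ _ => 0); exact: polyf_cst.
- by eexists; apply: polyfD; eassumption.
- by eexists; apply: polyfD; apply: polyfM; eassumption.
Qed.

Lemma polyf_smooth f df (U : set V) : polyf f df -> @smooth_on R V R^o U f.
Proof.
move=> fdf k; elim: k f df fdf => [|k IH] f df fdf /=.
  move=> x _; apply: differentiable_continuous.
  exact: (@ex_diff _ _ _ _ _ _ _ (polyf_is_diff x fdf)).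
split=> [x _|v].
  exact: (@ex_diff _ _ _ _ _ _ _ (polyf_is_diff x fdf)).
have [d2f fd2f] := polyf_derive v fdf.
apply: (IH _ d2f); rewrite (_ : (fun _ => _) = df ^~ v) //.
apply/funext => x.
by rewrite (@diff_val _ _ _ _ _ _ _ (polyf_is_diff x fdf)).
Qed.

End polynomial_functions.

Section entry.
Context (R : realType) (n : nat) (i : 'I_n).

(** A named coordinate function, so that its linearity can be inferred. *)
Definition entry (x : 'rV[R]_n) : R := x 0 i.

Fact entry_linear : linear entry.
Proof. by move=> a x y; rewrite /entry !mxE. Qed.

HB.instance Definition _ :=
  GRing.isLinear.Build R 'rV[R]_n R _ entry entry_linear.

Lemma entry_continuous : continuous entry.
Proof. exact: coord_continuous. Qed.

End entry.

Section polynomial_maps.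
Context (R : realType) (V : normedModType R) (n : nat).
Implicit Types (f : V -> 'rV[R]_n) (df : V -> V -> 'rV[R]_n).

Definition poly_map f df :=
  forall i, polyf (fun x => f x 0 i) (fun x v => df x v 0 i).

Lemma rV_differentiable f x :
  (forall i, differentiable (fun y => f y 0 i) x) -> differentiable f x.
Proof.
move=> df; rewrite (_ : f = \sum_i (fun y => f y 0 i *: 'e_i)); last first.
  by apply/funext => y; rewrite fct_sumE -row_sum_delta.
by apply: differentiable_sum => i; exact: differentiableZl.
Qed.

Lemma diff_rV f x v i : differentiable f x ->
  'd f x v 0 i = 'd (fun y => f y 0 i) x v.
Proof.
move=> df; have ec := @entry_continuous R n i.
rewrite -[fun y => _]/(entry i \o f) (@diff_comp _ _ _ _ f (entry i)) //.
  by rewrite (diff_lin _ ec).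
exact: linear_differentiable.
Qed.

Lemma poly_map_is_diff f df x : poly_map f df -> is_diff x f (df x).
Proof.
move=> fdf.
have dif : differentiable f x.
  apply: rV_differentiable => i.
  exact: (@ex_diff _ _ _ _ _ _ _ (polyf_is_diff x (fdf i))).
apply: DiffDef => //; apply/funext => v; apply/rowP => i.
rewrite diff_rV //.
by rewrite (@diff_val _ _ _ _ _ _ _ (polyf_is_diff x (fdf i))).
Qed.

Lemma poly_map_diff f df x v : poly_map f df -> 'd f x v = df x v.
Proof.
by move=> fdf; rewrite (@diff_val _ _ _ _ _ _ _ (poly_map_is_diff x fdf)).
Qed.

Lemma poly_map_smooth f df (U : set V) : poly_map f df -> smooth_on U f.
Proof.
move=> fdf k; elim: k f df fdf => [|k IH] f df fdf /=.
  move=> x _; apply: differentiable_continuous.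
  exact: (@ex_diff _ _ _ _ _ _ _ (poly_map_is_diff x fdf)).
split=> [x _|v].
  exact: (@ex_diff _ _ _ _ _ _ _ (poly_map_is_diff x fdf)).
have /boolp.choice[d2 fd2] := fun i => polyf_derive v (fdf i).
apply: (IH _ (fun x w => \row_i d2 i x w)) => i.
under eq_fun do rewrite (poly_map_diff _ _ fdf).
by apply: polyf_eq (fd2 i) _ => x w; rewrite mxE.
Qed.

Lemma poly_map_continuous f df : poly_map f df -> continuous f.
Proof.
move=> fdf x; apply: differentiable_continuous.
exact: (@ex_diff _ _ _ _ _ _ _ (poly_map_is_diff x fdf)).
Qed.

End polynomial_maps.

Section coordinates.
Context (R : realType).

Lemma polyf_coord n (i : 'I_n) :
  polyf (fun x : 'rV[R]_n => x 0 i) (fun _ v => v 0 i).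
Proof. exact: (@polyf_lin _ _ (entry i)) (@entry_continuous _ _ _). Qed.

Lemma polyf_coord1 n (V : normedModType R) (i : 'I_n) :
  polyf (fun x : 'rV[R]_n * V => x.1 0 i) (fun _ v => v.1 0 i).
Proof.
apply: (@polyf_lin _ _ (entry i \o fst)) => x.
by apply: continuous_comp; [exact: cvg_fst|exact: entry_continuous].
Qed.

Lemma polyf_coord2 n (V : normedModType R) (i : 'I_n) :
  polyf (fun x : V * 'rV[R]_n => x.2 0 i) (fun _ v => v.2 0 i).
Proof.
apply: (@polyf_lin _ _ (entry i \o snd)) => x.
by apply: continuous_comp; [exact: cvg_snd|exact: entry_continuous].
Qed.

Lemma polyf_id : polyf (fun x : R^o => x) (fun _ v => v).
Proof. by apply: (@polyf_lin _ _ (@idfun R^o)) => x; exact: cvg_id. Qed.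

End coordinates.

Section combinators.
Context (R : realType) (V : normedModType R).

Lemma poly_map_eq n (f : V -> 'rV[R]_n) df dg :
  poly_map f df -> (forall x v, df x v = dg x v) -> poly_map f dg.
Proof. by move=> fdf e i; apply: polyf_eq (fdf i) _ => x v; rewrite e. Qed.

Lemma polyf_entry n (f : V -> 'rV[R]_n) df i : poly_map f df ->
  polyf (fun x => f x 0 i) (fun x v => df x v 0 i).
Proof. exact. Qed.

Lemma poly_map_cst n (c : 'rV[R]_n) : poly_map (fun _ : V => c) (fun _ _ => 0).
Proof.
by move=> i; apply: polyf_eq; [exact: polyf_cst|move=> x v; rewrite mxE].
Qed.

Lemma poly_mapD n (f : V -> 'rV[R]_n) df g dg :
  poly_map f df -> poly_map g dg ->
  poly_map (fun x => f x + g x) (fun x v => df x v + dg x v).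
Proof.
move=> fdf gdg i; under eq_fun do rewrite mxE.
by apply: polyf_eq (polyfD (fdf i) (gdg i)) _ => x v; rewrite mxE.
Qed.

Lemma poly_mapN n (f : V -> 'rV[R]_n) df : poly_map f df ->
  poly_map (fun x => - f x) (fun x v => - df x v).
Proof.
move=> fdf i; under eq_fun do rewrite mxE.
by apply: polyf_eq (polyfN (fdf i)) _ => x v; rewrite mxE.
Qed.

Lemma poly_mapZ n (f : V -> 'rV[R]_n) df g dg : polyf g dg -> poly_map f df ->
  poly_map (fun x => g x *: f x) (fun x v => g x *: df x v + dg x v *: f x).
Proof.
move=> gdg fdf i; under eq_fun do rewrite mxE.
by apply: polyf_eq (polyfM gdg (fdf i)) _ => x v; rewrite !mxE; ring.
Qed.

(** Separate from [poly_mapZ] to keep null terms out of the differentials. *)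
Lemma poly_mapZc n (c : R) (f : V -> 'rV[R]_n) df : poly_map f df ->
  poly_map (fun x => c *: f x) (fun x v => c *: df x v).
Proof.
move=> fdf i; under eq_fun do rewrite mxE.
apply: polyf_eq (polyfM (polyf_cst _ c) (fdf i)) _ => x v.
by rewrite !mxE; ring.
Qed.

Lemma poly_map_lsub m n (f : V -> 'rV[R]_(m + n)) df : poly_map f df ->
  poly_map (fun x => lsubmx (f x)) (fun x v => lsubmx (df x v)).
Proof.
move=> fdf i; under eq_fun do rewrite mxE.
by apply: polyf_eq (fdf _) _ => x v; rewrite mxE.
Qed.

Lemma poly_map_row n (f : V -> 'rV[R]_n) df g dg :
  poly_map f df -> polyf g dg ->
  poly_map (fun x => row_mx (f x) (g x)%:M : 'rV[R]_(n + 1))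
           (fun x v => row_mx (df x v) (dg x v)%:M).
Proof.
move=> fdf gdg i; case: (split_ordP i) => j ->.
  under eq_fun do rewrite row_mxEl.
  by apply: polyf_eq (fdf j) _ => x v; rewrite row_mxEl.
under eq_fun do rewrite row_mxEr ord1 mxE eqxx mulr1n.
by apply: polyf_eq gdg _ => x v; rewrite row_mxEr ord1 mxE eqxx mulr1n.
Qed.

End combinators.

Lemma poly_map_id (R : realType) n :
  poly_map (fun x : 'rV[R]_n => x) (fun _ v => v).
Proof. by move=> i; exact: polyf_coord. Qed.

Lemma poly_map_fst (R : realType) n (V : normedModType R) :
  poly_map (fun x : 'rV[R]_n * V => x.1) (fun _ v => v.1).
Proof. by move=> i; exact: polyf_coord1. Qed.

Lemma poly_map_snd (R : realType) n (V : normedModType R) :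
  poly_map (fun x : V * 'rV[R]_n => x.2) (fun _ v => v.2).
Proof. by move=> i; exact: polyf_coord2. Qed.

(** * Row vectors as a manifold *)

(** Balls of radius 1/(k+1) around rational points form a countable basis. *)
Lemma rV_second_countable (R : realType) n : @second_countable 'rV[R]_n.
Proof.
pose b (qk : 'rV[rat]_n * nat) : set 'rV[R]_n :=
  ball (map_mx ratr qk.1 : 'rV[R]_n) qk.2.+1%:R^-1.
exists (range b); first exact: sub_countable (card_image_le _ _) (countableP _).
split; first by move=> _ [qk _ <-]; exact: ball_open.
move=> x A /nbhs_ballP[e e0 xeA].
have [k /= ke] : exists k : nat, k.+1%:R^-1 < e / 2.
  have := near_infty_natSinv_lt (PosNum (divr_gt0 e0 (ltr0Sn R 1))).
  by case=> k _ /(_ k (leqnn k)) /= ?; exists k.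
have k0 : 0 < k.+1%:R^-1 :> R by rewrite invr_gt0.
have qE i : exists q : rat, `|ratr q - x 0 i| < k.+1%:R^-1.
  have /rat_in_itvoo[q] : x 0 i < x 0 i + k.+1%:R^-1 by rewrite ltrDl.
  rewrite in_itv /= => /andP[q1 q2]; exists q.
  by rewrite ger0_norm ?subr_ge0 ?(ltW q1)// ltrBlDl.
have /boolp.choice[q qx] := qE.
have bx : b (\row_i q i, k) x.
  by split => // i j; rewrite ord1 !mxE; exact: qx.
exists (b (\row_i q i, k)); first by split=> //; exists (\row_i q i, k).
have be z w : ball (z : 'rV[R]_n) k.+1%:R^-1 w -> ball z (e / 2) w.
  by apply: le_ball; exact: ltW.
by move=> y /= qy; apply: xeA; apply: ball_split; apply: be;
  [exact/ball_sym/bx|exact: qy].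
Qed.

Lemma model_manifold (R : realType) n : is_manifold (model_mfd 'rV[R]_n).
Proof.
have cE : cod (id_chart 'rV[R]_n) = setT by rewrite /cod /= image_id.
split.
- exact: norm_hausdorff.
- exact: rV_second_countable.
- move=> _ ->; split; rewrite ?cE //=; try exact: openT.
  + by move=> p _; exact: cvg_id.
  + by move=> p _; exact: cvg_id.
- by [].
- move=> _ _ -> -> /=.
  by apply: poly_map_smooth => i; exact: polyf_coord.
Qed.

Lemma model_smooth (R : realType) (V : normedModType R) n
    (f : V -> 'rV[R]_n) df :
  poly_map f df -> smooth_map (M := model_mfd V) (N := model_mfd 'rV[R]_n) f.
Proof.
move=> fdf; split; first exact: (poly_map_continuous fdf).
by move=> _ _ -> -> /=; exact: (poly_map_smooth _ fdf).
Qed.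

Lemma model_smooth2 (R : realType) m n p
  (f : 'rV[R]_m * 'rV[R]_n -> 'rV[R]_p) df :
  poly_map f df ->
  smooth_map (M := prod_mfd (model_mfd 'rV[R]_m) (model_mfd 'rV[R]_n))
             (N := model_mfd 'rV[R]_p) f.
Proof.
move=> fdf; split; first exact: (poly_map_continuous fdf).
move=> _ _ [_ -> [_ -> <-]] -> /=.
rewrite (_ : _ \o _ = f); first exact: (poly_map_smooth _ fdf).
by apply/funext => -[].
Qed.

Lemma model_tmap (R : realType) (V : normedModType R) n
    (f : V -> 'rV[R]_n) df x v :
  poly_map f df ->
  tmap (M := model_mfd V) (N := model_mfd 'rV[R]_n) f x v = df x v.
Proof. by move=> fdf; rewrite -(poly_map_diff x v fdf). Qed.

(** Loops are contracted along straight lines to their base point. *)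
Lemma rV_simply_connected (R : realType) n : simply_connected R 'rV[R]_n.
Proof.
split; first by exists 0.
- move=> x y; exists (fun t => x + t *: (y - x)); split.
  + apply: continuous_subspaceT => t; apply: cvgD; first exact: cvg_cst.
    exact: scalel_continuous.
  + by rewrite scale0r addr0.
  + by rewrite scale1r addrC subrK.
- move=> f fc f01; exists (fun st => f st.2 + st.1 *: (f 0 - f st.2)); split.
    apply/subspace_continuousP => -[s t] [/= _ t01].
    have f2 : f st.2 @[st --> within (`[0, 1] `*` `[0, 1]) (nbhs (s, t))] -->
        f t.
      move/subspace_continuousP : fc => /(_ _ t01); apply: cvg_comp => W /= WA.
      have : \forall st \near (s, t), st.2 \in `[0, 1] -> W st.2.
        have {}WA : \forall u \near t, u \in `[0, 1] -> W u := WA.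
        exact: (@cvg_snd _ _ (nbhs s) (nbhs t) _ _ WA).
      by apply: filterS => -[s' t'] /= + [_ ?]; exact.
    apply: (cvgD f2); apply: cvgZ; last by apply: cvgB => //; exact: cvg_cst.
    by apply: cvg_within_filter; exact: cvg_fst.
  move=> t; rewrite in_itv /= => /andP[t0 t1]; split.
  - by rewrite /= scale0r addr0.
  - by rewrite /= scale1r addrC subrK.
  - by rewrite /= subrr scaler0 addr0.
  - by rewrite /= -f01 subrr scaler0 addr0.
Qed.

(** Reduces the bracket to symbolic differentiation when the manifold of the
    group is a vector space and the left-invariant fields are polynomial. *)
Lemma model_lie_bracket (R : realType) n
    (mul : 'rV[R]_n -> 'rV[R]_n -> 'rV[R]_n) inv
    (G := @LieGroup R n (model_mfd 'rV[R]_n) mul inv 0)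
    (F : 'rV[R]_n -> 'rV[R]_n -> 'rV[R]_n) dF v w :
  (forall v, left_invariant_field G v = F v) ->
  (forall v, poly_map (F v) (dF v)) ->
  lie_bracket G v w = dF w 0 (F v 0) - dF v 0 (F w 0).
Proof.
move=> FE FdF; rewrite /lie_bracket !FE /=.
by congr (_ - _); exact: (poly_map_diff _ _ (FdF _)).
Qed.

(** * The Lie algebra, its form and the skew derivation *)

Lemma ord4P (P : 'I_4 -> Prop) : P i2 -> P i3 -> P i4 -> P i5 -> forall i, P i.
Proof.
move=> P2 P3 P4 P5 [[|[|[|[|//]]]] lti].
- by rewrite (_ : Ordinal _ = i2) //; exact/val_inj.
- by rewrite (_ : Ordinal _ = i3) //; exact/val_inj.
- by rewrite (_ : Ordinal _ = i4) //; exact/val_inj.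
- by rewrite (_ : Ordinal _ = i5) //; exact/val_inj.
Qed.

Section algebra.
Context (R : realType).
Implicit Types x y z : 'rV[R]_4.
Local Notation br := (@n_bracket R).

(** The nilpotent skew derivation D: e2 |-> e3 |-> e4 |-> 0. *)
Definition der x : 'rV[R]_4 := x 0 i2 *: e3 + x 0 i3 *: e4.

(** The exponential series of [s *: der] stops here, as D^3 = 0. *)
Definition expD (s : R) x : 'rV[R]_4 :=
  x + s *: der x + (s ^+ 2 / 2) *: der (der x).

(** The group law of N. *)
Definition nmul x y : 'rV[R]_4 := x + y + 2^-1 *: br x y.

Lemma rV4P x y : x 0 i2 = y 0 i2 -> x 0 i3 = y 0 i3 -> x 0 i4 = y 0 i4 ->
  x 0 i5 = y 0 i5 -> x = y.
Proof. by move=> *; apply/rowP; exact: ord4P. Qed.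

Lemma e2E : ((e2 0 i2 = 1 :> R) * (e2 0 i3 = 0 :> R) * (e2 0 i4 = 0 :> R) *
  (e2 0 i5 = 0 :> R))%type.
Proof. by rewrite /e2 !mxE. Qed.

Lemma e3E : ((e3 0 i2 = 0 :> R) * (e3 0 i3 = 1 :> R) * (e3 0 i4 = 0 :> R) *
  (e3 0 i5 = 0 :> R))%type.
Proof. by rewrite /e3 !mxE. Qed.

Lemma e4E : ((e4 0 i2 = 0 :> R) * (e4 0 i3 = 0 :> R) * (e4 0 i4 = 1 :> R) *
  (e4 0 i5 = 0 :> R))%type.
Proof. by rewrite /e4 !mxE. Qed.

Lemma e5E : ((e5 0 i2 = 0 :> R) * (e5 0 i3 = 0 :> R) * (e5 0 i4 = 0 :> R) *
  (e5 0 i5 = 1 :> R))%type.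
Proof. by rewrite /e5 !mxE. Qed.

Lemma brE x y : ((br x y 0 i2 = 0) * (br x y 0 i3 = 0) * (br x y 0 i4 = 0) *
  (br x y 0 i5 = x 0 i2 * y 0 i3 - x 0 i3 * y 0 i2))%type.
Proof. by rewrite /n_bracket !mxE /= !mulr0 mulr1. Qed.

Lemma derE x : ((der x 0 i2 = 0) * (der x 0 i3 = x 0 i2) *
  (der x 0 i4 = x 0 i3) * (der x 0 i5 = 0))%type.
Proof. by rewrite /der !mxE /= !mulr0 !mulr1 !addr0 add0r. Qed.

(** [mxE] comes last: used earlier it would unfold the brackets and basis
    vectors that the other rules evaluate in one step. *)
Definition coordE := (brE, derE, e2E, e3E, e4E, e5E, mxE).

End algebra.

(** Proves an identity between vectors of n built from brackets, [der], [expD]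
    and [nmul], coordinate by coordinate. *)
Ltac vec := apply: rV4P; rewrite /nmul /expD !coordE; by field.

Section algebra_theory.
Context (R : realType).
Implicit Types x y z : 'rV[R]_4.
Local Notation br := (@n_bracket R).

Lemma n_lie : is_lie_algebra br.
Proof.
split.
- by move=> x a y z; vec.
- by move=> x a y z; vec.
- by move=> x; vec.
- by move=> x y z; vec.
Qed.

Lemma n_two_step : two_step_nilpotent br.
Proof.
split; last by move=> x y z; vec.
exists e2, e3 => /rowP/(_ i5); rewrite !coordE mulr1 mulr0 subr0.
by move/eqP; rewrite oner_eq0.
Qed.

Lemma n_form_pseudo : is_pseudo_scalar_product (@n_form R).
Proof.
split.
- by move=> x a y z; rewrite /n_form !mxE /=; ring.
- by move=> x y; rewrite /n_form; ring.
- move=> [x [_ x0 xy]]; apply: x0.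
  have := xy e2 (memvf _); have := xy e3 (memvf _).
  have := xy e4 (memvf _); have := xy e5 (memvf _).
  rewrite /n_form !coordE !(mulr0, mulr1, addr0, add0r, oppr0).
  move=> x5 /eqP; rewrite oppr_eq0 => /eqP x2 x3 /eqP.
  by rewrite oppr_eq0 => /eqP x4; apply: rV4P; rewrite mxE.
Qed.

Lemma br0x x : br 0 x = 0.
Proof. by vec. Qed.

Lemma brx0 x : br x 0 = 0.
Proof. by vec. Qed.

Lemma expD0 x : expD 0 x = x.
Proof. by vec. Qed.

Lemma expD_0 (s : R) : expD s 0 = 0.
Proof. by vec. Qed.

Lemma expDN s x : expD s (- x) = - expD s x.
Proof. by vec. Qed.

Lemma expD_add s t x : expD (s + t) x = expD s (expD t x).
Proof. by vec. Qed.

(** The automorphism property, equivalent to D being a derivation. *)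
Lemma expD_br s x y : expD s (br x y) = br (expD s x) (expD s y).
Proof. by vec. Qed.

(** The isometry property, equivalent to D being skew. *)
Lemma expD_form s x y : n_form (expD s x) (expD s y) = n_form x y.
Proof. by rewrite /n_form /expD !coordE; field. Qed.

Lemma nmul0 x : nmul x 0 = x.
Proof. by vec. Qed.

Lemma n0mul x : nmul 0 x = x.
Proof. by vec. Qed.

Lemma nmulNx x : nmul (- x) x = 0.
Proof. by vec. Qed.

Lemma nmulxN x : nmul x (- x) = 0.
Proof. by vec. Qed.

Lemma nmulA : associative (@nmul R).
Proof. by move=> x y z; vec. Qed.

Lemma expD_nmul s x y : expD s (nmul x y) = nmul (expD s x) (expD s y).
Proof. by vec. Qed.

Lemma n_not_ad_invariant : ~ ad_invariant br (@n_form R).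
Proof.
move=> /(_ e2 e3 e5); rewrite /n_form !coordE.
rewrite !(mulr0, mulr1, mul0r, addr0, subr0, oppr0, add0r).
by move/eqP; rewrite oner_eq0.
Qed.

End algebra_theory.

(** * Coordinate subspaces *)

Lemma span_deltaP (R : realType) n (s : seq 'I_n) (x : 'rV[R]_n) :
  x \in <<[seq 'e_i | i <- s]>>%VS <->
  forall i, i \notin s -> x 0 i = 0.
Proof.
split.
  elim: s x => [|j s IH] x /=.
    by rewrite span_nil memv0 => /eqP -> i _; rewrite mxE.
  rewrite span_cons => /memv_addP[_ /vlineP[k ->] [w /IH ws ->]] i.
  rewrite inE negb_or => /andP[ij /ws wi].
  by rewrite !mxE wi eqxx (negbTE ij) mulr0 addr0.
move=> xs; rewrite [x]row_sum_delta; apply: memv_suml => i _.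
have [si|/xs ->] := boolP (i \in s); last by rewrite scale0r mem0v.
by apply/memvZ/memv_span; exact: map_f.
Qed.

Lemma line_delta (R : realType) n (i : 'I_n) :
  <['e_i : 'rV[R]_n]>%VS = <<[seq 'e_i | i <- [:: i]]>>%VS.
Proof. by rewrite /= span_seq1. Qed.

Section decomposition.
Context (R : realType) (n : nat).

Lemma span_delta_add (s t : seq 'I_n) : (forall i, i \in s ++ t) ->
  (<<[seq 'e_i | i <- s]>> + <<[seq 'e_i | i <- t]>> =
   fullv :> {vspace 'rV[R]_n})%VS.
Proof.
move=> st; apply/vspaceP => x; rewrite memvf -span_cat -map_cat.
by apply/span_deltaP => i; rewrite st.
Qed.

Lemma span_delta_cap (s t : seq 'I_n) : (forall i, i \in s -> i \notin t) ->
  (<<[seq 'e_i | i <- s]>> :&: <<[seq 'e_i | i <- t]>> =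
   0 :> {vspace 'rV[R]_n})%VS.
Proof.
move=> st; apply/eqP; rewrite -subv0; apply/subvP => x.
rewrite memv_cap => /andP[/span_deltaP xs /span_deltaP xt].
rewrite memv0; apply/eqP/rowP => i; rewrite mxE.
by have [/st/xt|/xs] := boolP (i \in s).
Qed.

End decomposition.

Section subspaces_of_n.
Context (R : realType).
Local Notation br := (@n_bracket R).

(** Brackets lie in the line of e5, and only the coordinates 2 and 3 matter. *)
Lemma span_ideal (s : seq 'I_4) : (i2 \in s) || (i3 \in s) ==> (i5 \in s) ->
  is_ideal br <<[seq 'e_i | i <- s]>>%VS.
Proof.
move=> s5 x y /span_deltaP xs; apply/span_deltaP; apply: ord4P => s_;
  rewrite brE //.
move: s5; rewrite (negbTE s_) implybF negb_or => /andP[/xs -> /xs ->].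
by rewrite !mulr0 subrr.
Qed.

Lemma center_n : lie_center br = [set x | x \in <<[:: e4; e5 : 'rV[R]_4]>>%VS].
Proof.
apply/seteqP; split => x /=.
  move=> xc; apply/(@span_deltaP R 4 [:: i4; i5]).
  have x3 := congr1 (fun v : 'rV[R]_4 => v 0 i5) (xc e2).
  have x2 := congr1 (fun v : 'rV[R]_4 => v 0 i5) (xc e3).
  move: x2 x3; rewrite !coordE !mulr0 !mulr1 subr0 sub0r => x2 /eqP.
  by rewrite oppr_eq0 => /eqP x3; apply: ord4P.
move/(@span_deltaP R 4 [:: i4; i5]) => x45 y.
by apply: rV4P; rewrite brE mxE // !x45 // !mul0r subrr.
Qed.

(** The vector e4 pairs only with e2, which is not in the center. *)
Lemma center_degenerate : degenerate_on (@n_form R) <<[:: e4; e5]>>%VS.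
Proof.
exists e4; split.
- by apply: memv_span; rewrite inE eqxx.
- by move=> /rowP/(_ i4)/eqP; rewrite !coordE oner_eq0.
- move=> y /(@span_deltaP R 4 [:: i4; i5]) y45.
  rewrite /n_form !coordE (y45 i2) //.
  by rewrite !mul0r mulr0 !addr0 oppr0.
Qed.

End subspaces_of_n.

(** * Differentiation rules for the bracket, the flow of D and the product *)

Section combinators_of_n.
Context (R : realType) (V : normedModType R).
Implicit Types (f g : V -> 'rV[R]_4).

Lemma poly_map_br f df g dg : poly_map f df -> poly_map g dg ->
  poly_map (fun x => n_bracket (f x) (g x))
           (fun x v => n_bracket (df x v) (g x) + n_bracket (f x) (dg x v)).
Proof.
move=> fdf gdg; rewrite /n_bracket; apply: poly_map_eq.
  apply: poly_mapZ; last exact: poly_map_cst.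
  apply: polyfD; last apply: polyfN.
    exact: polyfM (polyf_entry _ fdf) (polyf_entry _ gdg).
  exact: polyfM (polyf_entry _ fdf) (polyf_entry _ gdg).
by move=> x v /=; rewrite scaler0 add0r -scalerDl; congr (_ *: _); ring.
Qed.

Lemma poly_map_der f df : poly_map f df ->
  poly_map (fun x => der (f x)) (fun x v => der (df x v)).
Proof.
move=> fdf; rewrite /der; apply: poly_map_eq.
  apply: poly_mapD; (apply: poly_mapZ; last exact: poly_map_cst);
    exact: polyf_entry fdf.
by move=> x v /=; rewrite !scaler0 !add0r.
Qed.

(** The derivative of exp(sD) with respect to s is D exp(sD). *)
Lemma poly_map_expD f df s ds : poly_map f df -> polyf s ds ->
  poly_map (fun x => expD (s x) (f x))
           (fun x v => expD (s x) (df x v) + ds x v *: der (expD (s x) (f x))).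
Proof.
move=> fdf sds; rewrite /expD; apply: poly_map_eq.
  apply: poly_mapD; first apply: poly_mapD => //.
    exact: poly_mapZ sds (poly_map_der fdf).
  apply: poly_mapZ; last exact: poly_map_der (poly_map_der fdf).
  apply: polyfM; last exact: polyf_cst.
  exact: (polyfM sds sds).
by move=> x v; vec.
Qed.

Lemma poly_map_nmul f df g dg : poly_map f df -> poly_map g dg ->
  poly_map (fun x => nmul (f x) (g x))
           (fun x v => df x v + dg x v + 2^-1 *:
              (n_bracket (df x v) (g x) + n_bracket (f x) (dg x v))).
Proof.
move=> fdf gdg; apply: poly_mapD; first exact: poly_mapD.
exact/poly_mapZc/poly_map_br.
Qed.

End combinators_of_n.

(** Computes a differential by following the syntax of the map. The head symbol
    alone selects the rule: up to unfolding, [nmul] is a sum, [n_bracket] a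
    scaling, and several rules would compete. The cases of unapplied functions
    arise because unification eta-reduces the maps that it finds. *)
Ltac poly := repeat lazymatch goal with
  | |- poly_map (fun _ => ?c) _ => apply: poly_map_cst
  | |- poly_map (fun x => x) _ => apply: poly_map_id
  | |- poly_map (fun x => x.1) _ => apply: poly_map_fst
  | |- poly_map fst _ => apply: poly_map_fst
  | |- poly_map snd _ => apply: poly_map_snd
  | |- poly_map (fun x => x.2) _ => apply: poly_map_snd
  | |- poly_map (@lsubmx _ _ _ _) _ =>
      apply: (poly_map_lsub (@poly_map_id _ _))
  | |- poly_map (fun x => row_mx _ _) _ => apply: poly_map_row
  | |- poly_map (fun x => lsubmx _) _ => apply: poly_map_lsub
  | |- poly_map (fun x => nmul _ _) _ => apply: poly_map_nmul
  | |- poly_map (fun x => expD _ _) _ => apply: poly_map_expD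
  | |- poly_map (fun x => n_bracket _ _) _ => apply: poly_map_br
  | |- poly_map (fun x => der _) _ => apply: poly_map_der
  | |- poly_map (fun x => - _) _ => apply: poly_mapN
  | |- poly_map (fun x => _ + _) _ => apply: poly_mapD
  | |- poly_map (fun x => ?c *: _) _ => apply: poly_mapZc
  | |- poly_map (fun x => _ *: _) _ => apply: poly_mapZ
  | |- polyf (fun _ => ?c) _ => apply: polyf_cst
  | |- polyf (fun x => x) _ => apply: polyf_id
  | |- polyf (fun x => - _) _ => apply: polyfN
  | |- polyf (fun x => _ + _) _ => apply: polyfD
  | |- polyf (fun x => _ * _) _ => apply: polyfM
  | |- polyf (fun x => _ 0 _) _ => apply: polyf_entry
  end.

(** * The group N and its left-invariant metric *)

Section nilpotent_group.
Context (R : realType).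
Implicit Types p u v w : 'rV[R]_4.
Local Notation br := (@n_bracket R).
Local Notation N := (bch2_group br).
Local Notation g := (left_invariant_metric (G := N) n_form).

Lemma nmul_is_lie_group : is_lie_group (bch2_group br).
Proof.
split.
- exact: model_manifold.
- exact: nmulA.
- by split; [exact: n0mul|exact: nmul0].
- by split; [exact: nmulNx|exact: nmulxN].
- split.
    have [df] : exists df,
        poly_map (fun x : 'rV[R]_4 * 'rV[R]_4 => nmul x.1 x.2) df.
      by eexists; poly.
    exact: model_smooth2.
  have [df] : exists df, poly_map (fun x : 'rV[R]_4 => - x) df.
    by eexists; exact: (poly_mapN (@poly_map_id R 4)).
  exact: model_smooth.
Qed.

Lemma nmul_ltrans (u : 'rV[R]_4) :
  poly_map (nmul u) (fun _ v : 'rV[R]_4 => v + 2^-1 *: br u v).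
Proof.
apply: poly_map_eq.
  exact: (poly_map_nmul (@poly_map_cst R _ _ u) (@poly_map_id R _)).
by move=> x v; rewrite /= add0r br0x add0r.
Qed.

Lemma nmul_rtrans (u : 'rV[R]_4) :
  poly_map (fun x : 'rV[R]_4 => nmul x u)
    (fun _ v : 'rV[R]_4 => v + 2^-1 *: br v u).
Proof.
apply: poly_map_eq.
  exact: (poly_map_nmul (@poly_map_id R _) (@poly_map_cst R _ _ u)).
by move=> x v; rewrite /= addr0 brx0 addr0.
Qed.

Lemma bch2_bracket : lie_bracket (bch2_group br) = br.
Proof.
apply/funext => v; apply/funext => w.
rewrite (@model_lie_bracket R 4 _ _ (fun v u => v + 2^-1 *: br u v)
                            (fun v _ (b : 'rV[R]_4) => 2^-1 *: br b v)).
- by rewrite !br0x scaler0 !addr0; vec.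
- move=> {}v; apply/funext => u; exact: (poly_map_diff _ _ (nmul_ltrans u)).
- move=> {}v; apply: poly_map_eq; first by poly.
  by move=> x b; rewrite /= add0r brx0 addr0.
Qed.

(** Translating by -p differentiates to v |-> v - [p, v] / 2, because
    [p, p] = 0. *)
Lemma metricE p v w : g p v w =
  n_form (v - 2^-1 *: br p v) (w - 2^-1 *: br p w).
Proof.
rewrite /left_invariant_metric.
have E u : tmap (M := N) (N := N) (lmul (linv (l := N) p)) p u =
    u - 2^-1 *: br p u.
  by rewrite (model_tmap _ _ (nmul_ltrans (- p))); vec.
by rewrite !E.
Qed.

(** Nondegeneracy is transported from the form by v |-> v - [p, v] / 2, whose
    inverse is v |-> v + [p, v] / 2. *)
Lemma g_pseudo : is_pseudo_riemannian g.
Proof.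
have [nl ns nd] := n_form_pseudo R.
split.
  move=> p; split.
  - move=> v a x y; rewrite !metricE.
    by rewrite -nl; congr n_form; vec.
  - by move=> v w; rewrite !metricE ns.
  - move=> [v [_ v0 vw]]; apply: nd; exists (v - 2^-1 *: br p v); split.
    + exact: memvf.
    + move=> v0'; apply: v0.
      transitivity ((v - 2^-1 *: br p v) + 2^-1 *: br p (v - 2^-1 *: br p v)).
        by vec.
      by rewrite v0' brx0 scaler0 addr0.
    + move=> y _; have := vw (y + 2^-1 *: br p y) (memvf _).
      by rewrite metricE => <-; congr n_form; vec.
move=> _ -> v w.
have prefE (q a : 'rV[R]_4) : @to_preferred R 4 N (id_chart _) q a = a.
  exact: (poly_map_diff _ _ (@poly_map_id R 4)).
under eq_fun => q do rewrite !prefE metricE /n_form.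
have pE (u : 'rV[R]_4) : poly_map (fun p : 'rV[R]_4 => u - 2^-1 *: br p u)
    (fun _ (b : 'rV[R]_4) => - (2^-1 *: br b u)).
  apply: poly_map_eq; first by poly.
  by move=> x b; rewrite /= add0r brx0 addr0.
apply: polyf_smooth.
apply: polyfD; first apply: polyfD.
- by apply: polyfN; apply: polyfD; apply: polyfM; apply: polyf_entry; exact: pE.
- by apply: polyfM; apply: polyf_entry; exact: pE.
- by apply: polyfM; apply: polyf_entry; exact: pE.
Qed.

(** Right translation by e3 sends the vectors e2 and e5 at the identity to the
    values at e3 of the left-invariant fields e2 + e5 and e5, so that their
    product changes from 0 to 1. *)
Lemma g_not_bi_invariant : ~ bi_invariant g.
Proof.
move=> /(_ e3)[_ /(_ 0 e2 e5)].
have E (v : 'rV[R]_4) :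
    tmap (M := N) (N := N) (fun x => lmul (l := N) x e3) 0 v =
    v + 2^-1 *: br v e3.
  exact: (model_tmap _ _ (nmul_rtrans e3)).
rewrite !E (n0mul e3 : lmul (l := N) 0 e3 = e3) !metricE !br0x scaler0 !subr0.
have -> : e2 + 2^-1 *: br e2 e3 - 2^-1 *: br e3 (e2 + 2^-1 *: br e2 e3) =
    e2 + e5 by vec.
have -> : e5 + 2^-1 *: br e5 e3 - 2^-1 *: br e3 (e5 + 2^-1 *: br e5 e3) = e5
  by vec.
rewrite /n_form !coordE !(mulr0, mulr1, mul0r, addr0, oppr0, add0r).
by move/eqP; rewrite oner_eq0.
Qed.

End nilpotent_group.

(** * The transitive group G, extension of N by the flow of D *)

Section extended_group.
Context (R : realType).
Implicit Types x p : 'rV[R]_4.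
Implicit Types a b c : 'rV[R]_(4 + 1).

(** An element of G is a row vector of size 4 + 1: its component in N and the
    parameter s of exp(sD), which is read here. *)
Definition flow_time a : R := a 0 (rshift 4 0).

(** The element (x, s) of G acts on N by p |-> x * exp(sD) p. *)
Definition ext_act a p : 'rV[R]_4 := nmul (lsubmx a) (expD (flow_time a) p).

Definition ext_mul a b : 'rV[R]_(4 + 1) :=
  row_mx (ext_act a (lsubmx b)) (flow_time a + flow_time b)%:M.

Definition ext_inv a : 'rV[R]_(4 + 1) :=
  row_mx (- expD (- flow_time a) (lsubmx a)) (- flow_time a)%:M.

Definition ext_group : lie_group R (4 + 1) :=
  @LieGroup R (4 + 1) (model_mfd 'rV[R]_(4 + 1)) ext_mul ext_inv 0.

Lemma flow_time_row x (s : R) : flow_time (row_mx x s%:M) = s.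
Proof. by rewrite /flow_time row_mxEr mxE eqxx mulr1n. Qed.

Lemma row_eta a : row_mx (lsubmx a) (flow_time a)%:M = a.
Proof.
rewrite -[RHS]hsubmxK; congr row_mx; apply/rowP => i.
by rewrite ord1 /flow_time !mxE eqxx mulr1n.
Qed.

Lemma lsub0 : lsubmx (0 : 'rV[R]_(4 + 1)) = 0.
Proof. by apply/rowP => i; rewrite !mxE. Qed.

Lemma flow_time0 : flow_time 0 = 0.
Proof. by rewrite /flow_time mxE. Qed.

Lemma ext_act1 p : ext_act 0 p = p.
Proof. by rewrite /ext_act lsub0 flow_time0 expD0 n0mul. Qed.

Lemma ext_act_at0 a : ext_act a 0 = lsubmx a.
Proof. by rewrite /ext_act expD_0 nmul0. Qed.

Lemma ext_actM a b p : ext_act (ext_mul a b) p = ext_act a (ext_act b p).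
Proof.
by rewrite /ext_act /ext_mul row_mxKl flow_time_row expD_add expD_nmul nmulA.
Qed.

Lemma ext_group_lie : is_lie_group ext_group.
Proof.
split.
- exact: model_manifold.
- move=> a b c; change (ext_mul a (ext_mul b c) = ext_mul (ext_mul a b) c).
  by rewrite {1 3}/ext_mul ext_actM /ext_mul !row_mxKl !flow_time_row addrA.
- split=> a.
    change (ext_mul 0 a = a).
    by rewrite /ext_mul ext_act1 flow_time0 add0r row_eta.
  change (ext_mul a 0 = a).
  by rewrite /ext_mul lsub0 flow_time0 addr0 ext_act_at0 row_eta.
- split=> a.
    change (ext_mul (ext_inv a) a = 0).
    rewrite /ext_mul /ext_act /ext_inv row_mxKl flow_time_row nmulNx addNr.
    by rewrite raddf0 row_mx0.
  change (ext_mul a (ext_inv a) = 0).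
  rewrite /ext_mul /ext_act /ext_inv row_mxKl flow_time_row expDN.
  by rewrite -expD_add subrr expD0 nmulxN raddf0 row_mx0.
- split.
    have [df] : exists df, poly_map (fun x : 'rV[R]_(4 + 1) * 'rV[R]_(4 + 1) =>
        ext_mul x.1 x.2) df.
      by eexists; rewrite /ext_mul /ext_act /flow_time; poly.
    exact: model_smooth2.
  have [df] : exists df, poly_map ext_inv df.
    by eexists; rewrite /ext_inv /flow_time; poly.
  exact: model_smooth.
Qed.

End extended_group.

Section extended_group_action.
Context (R : realType).
Implicit Types a : 'rV[R]_(4 + 1).
Local Notation br := (@n_bracket R).
Local Notation N := (bch2_group br).
Local Notation G := (ext_group R).
Local Notation g := (left_invariant_metric (G := N) n_form).

Lemma ext_group_field v u : left_invariant_field G v u =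
  row_mx (expD (flow_time u) (lsubmx v) +
          2^-1 *: br (lsubmx u) (expD (flow_time u) (lsubmx v)))
         (flow_time v)%:M.
Proof.
set F := fun a : 'rV[R]_(4 + 1) =>
  row_mx (expD (flow_time u) (lsubmx a) +
          2^-1 *: br (lsubmx u) (expD (flow_time u) (lsubmx a)))
         (flow_time a)%:M.
change ('d (ext_mul u) (0 : 'rV[R]_(4 + 1)) v = F v).
apply: (poly_map_diff (df := fun _ => F)).
apply: poly_map_eq; first by rewrite /ext_mul /ext_act /flow_time; poly.
move=> x w; rewrite {}/F /= /flow_time; congr row_mx; last by rewrite add0r.
by rewrite !scale0r !addr0 br0x !add0r.
Qed.

(** The bracket of the semidirect product of n by D. *)
Lemma ext_group_bracket v w : lie_bracket G v w =
  row_mx (br (lsubmx v) (lsubmx w) + flow_time v *: der (lsubmx w)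
            - flow_time w *: der (lsubmx v)) 0.
Proof.
pose dF (a x b : 'rV[R]_(4 + 1)) :=
  (* the derivative at x, in the direction b, of the field through a *)
    row_mx (flow_time b *: der (expD (flow_time x) (lsubmx a)) +
      2^-1 *: (br (lsubmx b) (expD (flow_time x) (lsubmx a)) +
        br (lsubmx x) (flow_time b *: der (expD (flow_time x) (lsubmx a)))))
      (0 : 'rV[R]_1).
rewrite (model_lie_bracket (dF := dF) _ _
          (fun a => funext (ext_group_field a))).
  rewrite /dF !row_mxKl !flow_time_row lsub0 flow_time0.
  rewrite opp_row_mx add_row_mx; congr row_mx.
    by rewrite !expD0 !br0x; vec.
  exact: subrr.
move=> a; apply: poly_map_eq; first by rewrite /flow_time; poly.
move=> x b; rewrite {}/dF /=; congr row_mx; last by rewrite raddf0.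
by rewrite expD_0 add0r.
Qed.

Lemma ext_act_diff a : poly_map (ext_act a) (fun p v : 'rV[R]_4 =>
  expD (flow_time a) v + 2^-1 *: br (lsubmx a) (expD (flow_time a) v)).
Proof.
apply: poly_map_eq.
  apply: (poly_map_nmul (@poly_map_cst R _ _ (lsubmx a))).
  exact: (poly_map_expD (@poly_map_id R _) (@polyf_cst R _ (flow_time a))).
by move=> p v; rewrite /= !scale0r !addr0 br0x !add0r.
Qed.

(** Translations are isometric by construction of the metric, and exp(sD) is so
    because it is an automorphism preserving the form. *)
Lemma ext_act_isometric : is_isometric_action g (G := G) (@ext_act R).
Proof.
split.
- exact: ext_act1.
- exact: ext_actM.
- have [df] : exists df, poly_map (fun x : 'rV[R]_(4 + 1) * 'rV[R]_4 =>
      ext_act x.1 x.2) df.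
    by eexists; rewrite /ext_act /flow_time; poly.
  exact: model_smooth2.
- move=> a p v w.
  have E u : tmap (M := N) (N := N) (ext_act a) p u =
      expD (flow_time a) u + 2^-1 *: br (lsubmx a) (expD (flow_time a) u).
    exact: (model_tmap _ _ (ext_act_diff a)).
  rewrite !E !metricE -[RHS](expD_form (flow_time a)).
  (* translating back to the identity turns the differential of the action
     into the automorphism expD, whatever the translation part of a *)
  have F u (s := flow_time a) (A := lsubmx a) (U := expD s u) :
      U + 2^-1 *: br A U -
        2^-1 *: br (ext_act a p) (U + 2^-1 *: br A U) =
      expD s (u - 2^-1 *: br p u).
    have -> : expD s (u - 2^-1 *: br p u) =
        U - 2^-1 *: br (expD s p) U by rewrite -expD_br; vec.
    by rewrite /ext_act -/s -/A; move: (expD s p) U A => P U A; vec.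
  by rewrite !F.
Qed.

End extended_group_action.

(** * The reductive complement and natural reductivity *)

Section reductive_complement.
Context (R : realType).
Implicit Types a b v : 'rV[R]_(4 + 1).
Local Notation br := (@n_bracket R).
Local Notation N := (bch2_group br).
Local Notation g := (left_invariant_metric (G := N) n_form).
Local Notation G := (ext_group R).

(** The linear form whose kernel is the complement m, spanned by e2, e3, e4 and
    e5 + D; it takes the value 1 on D. *)
Definition slant (a : 'rV[R]_(4 + 1)) : R^o := flow_time a - lsubmx a 0 i5.

Fact slant_linear : linear slant.
Proof.
by move=> k a b; rewrite /slant /flow_time /GRing.scale /= !mxE; ring.
Qed.

HB.instance Definition _ :=
  GRing.isLinear.Build R 'rV[R]_(4 + 1) R^o _ slant slant_linear.

(** The derivation D as an element of the Lie algebra of G. *)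
Definition flow_gen : 'rV[R]_(4 + 1) := row_mx 0 1%:M.

Definition iso_space : {vspace 'rV[R]_(4 + 1)} := <[flow_gen]>%VS.

Definition nat_compl : {vspace 'rV[R]_(4 + 1)} := lker (linfun slant).

Lemma nat_complP a : (a \in nat_compl) = (flow_time a == lsubmx a 0 i5).
Proof. by rewrite memv_ker lfunE /= /slant subr_eq0. Qed.

Lemma iso_spaceP a : a \in iso_space <-> lsubmx a = 0.
Proof.
split=> [/vlineP[k ->]|a0].
  by rewrite linearZ /= row_mxKl scaler0.
apply/vlineP; exists (flow_time a); rewrite -[LHS]row_eta a0 scale_row_mx.
by rewrite scaler0 scale_scalar_mx mulr1.
Qed.

Lemma slant_flow_gen : slant flow_gen = 1.
Proof. by rewrite /slant flow_time_row row_mxKl mxE subr0. Qed.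

Lemma slant_split a :
  a - slant a *: flow_gen \in nat_compl /\ slant a *: flow_gen \in iso_space.
Proof.
split; last by apply/vlineP; exists (slant a).
rewrite memv_ker lfunE /= linearB linearZ /= slant_flow_gen.
by rewrite /GRing.scale /= mulr1 subrr.
Qed.

Lemma iso_cap_compl : (iso_space :&: nat_compl = 0)%VS.
Proof.
apply/eqP; rewrite -subv0; apply/subvP => a.
rewrite memv_cap memv0 => /andP[/iso_spaceP a0].
rewrite nat_complP a0 mxE => /eqP s0; apply/eqP.
by rewrite -[a]row_eta a0 s0 raddf0 row_mx0.
Qed.

Lemma iso_add_compl : (iso_space + nat_compl = fullv)%VS.
Proof.
apply/vspaceP => a; rewrite memvf; have [am ah] := slant_split a.
by rewrite -[a](subrK (slant a *: flow_gen)) addrC memv_add.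
Qed.

(** Since [flow_gen] has no component in n, this projection does not change the
    component in n. *)
Lemma compl_proj a : daddv_pi nat_compl iso_space a = a - slant a *: flow_gen.
Proof.
have [am ah] := slant_split a.
have cap := iso_cap_compl.
have cap' : (nat_compl :&: iso_space = 0)%VS by rewrite capvC.
rewrite -{1}[a](subrK (slant a *: flow_gen)) linearD /=.
rewrite (daddv_pi_id cap' am).
have := daddv_pi_add cap' (subvP (addvSr _ _) _ ah).
rewrite (daddv_pi_id cap ah) => /(canRL (addrK _)) ->.
by rewrite subrr addr0.
Qed.

(** The identification of m with the tangent space n of N forgets D. *)
Lemma orbit_tmap a : tmap (M := G) (N := N)
  ((@ext_act R) ^~ 0) 0 a = lsubmx a.
Proof.
rewrite (_ : _ ^~ 0 = lsubmx); last by apply/funext => b; rewrite ext_act_at0.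
exact: (model_tmap _ _ (poly_map_lsub (@poly_map_id R (4 + 1)))).
Qed.

(** Conjugation by an element of the isotropy group acts on the factor N by the
    linear map exp(sD) and fixes the factor R. *)
Lemma Ad_isotropy a v : lsubmx a = 0 ->
  Ad (G := G) a v =
  row_mx (expD (flow_time a) (lsubmx v)) (flow_time v)%:M.
Proof.
move=> a0; rewrite /Ad.
have -> : (fun x : G => lmul (l := G) (lmul (l := G) a x) (linv (l := G) a)) =
    (fun x : G => row_mx (expD (flow_time a) (lsubmx x)) (flow_time x)%:M).
  apply/funext => x; change (ext_mul (ext_mul a x) (ext_inv a) =
     row_mx (expD (flow_time a) (lsubmx x)) (flow_time x)%:M).
  rewrite {1}/ext_mul /ext_inv a0 expD_0 oppr0 row_mxKl ext_act_at0.
  rewrite /ext_mul row_mxKl !flow_time_row /ext_act a0 n0mul.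
  by rewrite addrAC subrr add0r.
have P : poly_map (fun x : 'rV[R]_(4 + 1) =>
    row_mx (expD (flow_time a) (lsubmx x)) (flow_time x)%:M)
    (fun _ v => row_mx (expD (flow_time a) (lsubmx v)) (flow_time v)%:M).
  apply: poly_map_eq; first by rewrite /flow_time; poly.
  by move=> x w; rewrite /= scale0r addr0.
exact: (model_tmap _ _ P).
Qed.

Lemma isotropy_algebra :
  lie_algebra_of (G := G) [set a | ext_act a 0 = 0] =
  [set v | v \in iso_space].
Proof.
apply/seteqP; split => v /=.
  move=> [gamma [[[_ gs] _] gH ->]]; apply/iso_spaceP.
  have gd : differentiable (gamma : R^o -> 'rV[R]_(4 + 1)) 0.
    have [+ _] := gs (id_chart R^o) (id_chart _) erefl erefl 1%N.
    by apply; split => //; exists 0.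
  change (lsubmx ('d (gamma : R^o -> 'rV[R]_(4 + 1)) 0 (1 : R^o)) = 0).
  (* a curve in the isotropy group has constant component in N *)
  apply/rowP => i; rewrite !mxE diff_rV //.
  rewrite (_ : (fun _ => _) = cst 0); first by rewrite diff_cst.
  apply/funext => t; have := gH t; rewrite /= ext_act_at0 => /rowP/(_ i).
  by rewrite !mxE.
(* conversely, v generates the one-parameter group of the elements (0, t s),
   where v = (0, s) *)
move=> /iso_spaceP v0.
have P : poly_map
    (fun t : R^o => row_mx 0 (t * flow_time v)%:M : 'rV[R]_(4 + 1))
    (fun _ (s : R^o) => row_mx 0 (s * flow_time v)%:M).
  apply: poly_map_eq.
    by apply: poly_map_row; [exact: poly_map_cst|apply: polyfM; poly].
  by move=> t s; rewrite /= mulr0 add0r mulrC.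
exists (fun t : R => row_mx 0 (t * flow_time v)%:M); split.
- split; first exact: (model_smooth P).
  move=> s t; change (row_mx 0 ((s + t) * flow_time v)%:M =
    ext_mul (row_mx 0 (s * flow_time v)%:M) (row_mx 0 (t * flow_time v)%:M)).
  by rewrite /ext_mul !flow_time_row !row_mxKl ext_act_at0 row_mxKl mulrDl.
- by move=> t; rewrite /= ext_act_at0 row_mxKl.
- by rewrite (model_tmap _ _ P) mul1r -[LHS]row_eta v0.
Qed.

Lemma g_naturally_reductive : naturally_reductive g.
Proof.
split; [exact: model_manifold|exact: g_pseudo|].
exists (4 + 1)%N, G, (@ext_act R), 0, iso_space, nat_compl.
split.
- by split; [exact: ext_group_lie|exact: ext_act_isometric].
- (* left translations alone are already transitive *)
  move=> x y; exists (row_mx (nmul y (- x)) 0%:M).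
  by rewrite /ext_act row_mxKl flow_time_row expD0 -nmulA nmulNx nmul0.
- split; first exact: isotropy_algebra.
  by split; [exact: iso_add_compl|exact: iso_cap_compl].
- move=> a x; rewrite /= ext_act_at0 => a0.
  rewrite Ad_isotropy // !nat_complP row_mxKl flow_time_row => /eqP ->.
  by rewrite /expD !coordE !mulr0 !addr0.
- move=> x y z; rewrite !nat_complP => /eqP xs /eqP ys /eqP zs.
  have ipE a b :
      g 0 (tmap (M := G) (N := N) ((@ext_act R) ^~ 0) (lone G) a)
          (tmap (M := G) (N := N) ((@ext_act R) ^~ 0) (lone G) b) =
      n_form (lsubmx a) (lsubmx b).
    by rewrite !orbit_tmap metricE !br0x scaler0 !subr0.
  have prE a : lsubmx (daddv_pi nat_compl iso_space a) = lsubmx a.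
    by rewrite compl_proj linearB linearZ /= row_mxKl scaler0 subr0.
  (* on the complement the time is the e5-coordinate, and the bracket becomes
     T(x, y) = [x, y] + x5 Dy - y5 Dx, paired with z into a determinant *)
  rewrite !ipE !prE !ext_group_bracket !row_mxKl xs ys zs.
  move: (lsubmx x) (lsubmx y) (lsubmx z) => {xs ys zs} X Y Z.
  by rewrite /n_form !coordE; ring.
Qed.

End reductive_complement.

Theorem mainTheorem1 (R : realType) :
  let N : lie_group R 4 := bch2_group n_bracket in
  let g := left_invariant_metric (G := N) n_form in
  (* n is a Lie algebra, 2-step nilpotent, and the direct sum of the ideals
     R e4 and h_3; the form is a (pseudo-)scalar product *)
  [/\ is_lie_algebra (@n_bracket R),
      two_step_nilpotent (@n_bracket R),
      is_ideal n_bracket <[e4 : 'rV[R]_4]>%VS /\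
        is_ideal n_bracket <<[:: e2; e3; e5 : 'rV[R]_4]>>%VS,
      (<[e4 : 'rV[R]_4]> + <<[:: e2; e3; e5]>> = fullv)%VS /\
        (<[e4 : 'rV[R]_4]> :&: <<[:: e2; e3; e5]>> = 0)%VS &
      is_pseudo_scalar_product (@n_form R)] /\
  (* N is the simply connected Lie group with Lie algebra n *)
  [/\ is_lie_group N, simply_connected R N & lie_bracket N = n_bracket] /\
  (* (i) *)
  (lie_center n_bracket = [set x | x \in <<[:: e4; e5 : 'rV[R]_4]>>%VS] /\
     degenerate_on n_form <<[:: e4; e5 : 'rV[R]_4]>>%VS) /\
  (* (ii) *)
  naturally_reductive g /\
  (* (iii) *)
  (~ ad_invariant n_bracket (@n_form R) /\ ~ bi_invariant g).
Proof.
move=> N g; split; last split; last split; last split; last split.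
- split.
  + exact: n_lie.
  + exact: n_two_step.
  + split; last exact: (@span_ideal R [:: i2; i3; i5]).
    by rewrite /e4 line_delta; exact: span_ideal.
  + rewrite /e4 line_delta; split.
      by apply: (@span_delta_add R 4 [:: i4] [:: i2; i3; i5]); exact: ord4P.
    by apply: (@span_delta_cap R 4 [:: i4] [:: i2; i3; i5]); exact: ord4P.
  + exact: n_form_pseudo.
- split; [exact: nmul_is_lie_group|exact: rV_simply_connected|].
  exact: bch2_bracket.
- by split; [exact: center_n|exact: center_degenerate].
- exact: g_naturally_reductive.
- exact: n_not_ad_invariant.
- exact: g_not_bi_invariant.
Qed.
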